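(* Let $R$ be a zero-sum-free commutative semiring, let $(\Sigma,O)$ be a scenario and let $f:\Gamma\to\Sigma$ be a bundle scenario. (1) An empirical model $e\in\mathrm{Emp}(\Sigma,O)$ is contextual if and only if $\eta_{(\Sigma,O)}(e)\in\mathrm{bEmp}(f_{(\Sigma,O)})$ is contextual. (2) An empirical model $p\in\mathrm{bEmp}(f)$ is contextual if and only if $\zeta_f(p)\in\mathrm{sDist}(Nf)$ is contextual.
   Context: **Distributions.** $R$ is zero-sum-free if $a+b=0$ implies $a=b=0$. $D_R(U)$ is the set of finitely supported $p:U\to R$ with $\sum_u p(u)=1$; for $g:U\to V$, $D_R(g)(p)(v)=\sum_{u\in g^{-1}(v)}p(u)$; $\delta^u\in D_R(U)$ is the delta distribution at $u$. $D_R$ is applied degreewise to simplicial sets, with $\delta_X:X\to D_R(X)$, $x\mapsto\delta^x$. **Simplicial complexes and bundle scenarios.** A simplicial complex $\Sigma$ has a vertex set $\Sigma_0$ and a set of simplices (also written $\Sigma$): finite subsets of $\Sigma_0$, closed under taking subsets, containing all singletons; $\emptyset$ counts as a simplex. A map $f:\Gamma\to\Sigma$ is a function $\Gamma_0\to\Sigma_0$ with $f(\gamma)=\{f(x):x\in\gamma\}\in\Sigma$ for all $\gamma\in\Gamma$. $\mathrm{St}(\sigma)=\{\sigma'\in\Sigma:\sigma\subset\sigma'\}$. A bundle scenario is a map $f:\Gamma\to\Sigma$ that is surjective on simplices, locally surjective ($f:\mathrm{St}(\gamma)\to\mathrm{St}(f(\gamma))$ is surjective for every nonempty $\gamma\in\Gamma$),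 and discrete over vertices ($\{x,y\}\notin\Gamma$ for distinct $x,y\in\Gamma_0$ with $f(x)=f(y)$). **Empirical models on scenarios.** A scenario $(\Sigma,O)$ is a simplicial complex $\Sigma$ with a family $O=\{O_x\}_{x\in\Sigma_0}$ of nonempty sets. For a set of vertices $\sigma$ put $\mathcal{E}_O(\sigma)=\prod_{x\in\sigma}O_x$. $\mathrm{Emp}(\Sigma,O)$ is the set of families $e=\{e_\sigma\in D_R(\mathcal{E}_O(\sigma))\}_{\sigma\in\Sigma}$ such that for $\sigma'\subset\sigma$, $e_{\sigma'}$ is the push-forward of $e_\sigma$ under restriction. Such an $e$ is non-contextual if there is $d\in D_R(\mathcal{E}_O(\Sigma_0))$ with $e_\sigma=\sum_{s}d(s)\,\delta^{s|_\sigma}$ for all $\sigma\in\Sigma$; otherwise contextual. **Empirical models on bundle scenarios.** For $\sigma'\subset\sigma$ in $\Sigma$ and $\gamma\in f^{-1}(\sigma)$ (i.e. $f(\gamma)=\sigma$) there is a unique $\gamma'\subset\gamma$ with $f(\gamma')=\sigma'$; let $r_{\sigma,\sigma'}(\gamma)=\gamma'$. $\mathrm{bEmp}(f)$ is the set of families $p=(p_\sigma\in D_R(f^{-1}(\sigma)))_{\sigma\in\Sigma}$ with $D_R(r_{\sigma,\sigma'})(p_\sigma)=p_{\sigma'}$ for $\sigma'\subset\sigma$. Let $\mathrm{bSect}(f)$ be the set of simplicial complex maps $s:\Sigma\to\Gamma$ with $f\circ s=\mathrm{id}_\Sigma$. Then $p$ is non-contextual if there is $d\in D_R(\mathrm{bSect}(f))$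 with $p_\sigma=\sum_s d(s)\,\delta^{s(\sigma)}$ for all $\sigma\in\Sigma$; otherwise contextual. **Simplicial distributions.** For a map $g:E\to X$ of simplicial sets, $\mathrm{sDist}(g)$ is the set of simplicial set maps $p:X\to D_R(E)$ with $D_R(g)\circ p=\delta_X$. Let $\mathrm{sSect}(g)$ be the set of simplicial set maps $s:X\to E$ with $g\circ s=\mathrm{id}_X$. Then $p$ is non-contextual if there is $d\in D_R(\mathrm{sSect}(g))$ with $p_n(x)=\sum_s d(s)\,\delta^{s_n(x)}$ for all $n$ and $x\in X_n$; otherwise contextual. **The comparison maps.** $\mathcal{E}_O\Sigma$ is the simplicial complex with vertices $(x,o)$, $x\in\Sigma_0$, $o\in O_x$, whose simplices are the pairs $(\sigma,s)$, $\sigma\in\Sigma$, $s\in\mathcal{E}_O(\sigma)$, viewed as the sets $\{(x,s(x)):x\in\sigma\}$; $f_{(\Sigma,O)}:\mathcal{E}_O\Sigma\to\Sigma$, $(\sigma,s)\mapsto\sigma$, is a bundle scenario. $\eta_{(\Sigma,O)}:\mathrm{Emp}(\Sigma,O)\to\mathrm{bEmp}(f_{(\Sigma,O)})$ is $\eta_{(\Sigma,O)}(e)_\sigma(\sigma,s)=e_\sigma(s)$. $N\Sigma$ is the simplicial set with $(N\Sigma)_n=\{(\sigma_1,\dots,\sigma_n)\in\Sigma^n:\bigcup\sigma_i\in\Sigma\}$ ($(N\Sigma)_0$ is a point), $d_0$ and $d_n$ deleting the first and the last entry, $d_i$ for $0<i<n$ replacing $\sigma_i,\sigma_{i+1}$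 by $\sigma_i\cup\sigma_{i+1}$, and $s_j$ inserting $\emptyset$ after $\sigma_j$; $Nf$ applies $f$ entrywise. $\zeta_f:\mathrm{bEmp}(f)\to\mathrm{sDist}(Nf)$ is $\zeta_f(p)_n(\sigma_1,\dots,\sigma_n)(\gamma_1,\dots,\gamma_n)=p_{\bigcup\sigma_i}(\bigcup\gamma_i)$ if $f(\gamma_i)=\sigma_i$ for all $i$, and $0$ otherwise. *)

(* Defs.v *)
From HB Require Import structures.
From mathcomp Require Import all_boot all_order all_algebra finmap.
From mathcomp Require Import mathcomp_extra boolp classical_sets functions.
From mathcomp Require Import cardinality fsbigop.

Set Implicit Arguments.
Unset Strict Implicit.
Unset Printing Implicit Defensive.

Import GRing.Theory.
Local Open Scope fset_scope.
Local Open Scope classical_set_scope.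
Local Open Scope ring_scope.

(* A commutative semiring is a [comPzSemiRingType]; the trivial semiring is
   allowed.  Sets are [choiceType]s, which under the classical axioms of
   [boolp] is no restriction. *)

Definition zero_sum_free (R : comPzSemiRingType) :=
  forall a b : R, a + b = 0 -> a = 0 /\ b = 0.

Record dist (R : comPzSemiRingType) (U : choiceType) := Dist {
  dist_fun :> U -> R;
  dist_finite : finite_set [set u | dist_fun u != 0];
  dist_sum1 : \sum_(u \in [set: U]) dist_fun u = 1 }.

HB.instance Definition _ (R : comPzSemiRingType) (U : choiceType) :=
  gen_eqMixin (dist R U).
HB.instance Definition _ (R : comPzSemiRingType) (U : choiceType) :=
  gen_choiceMixin (dist R U).

Section DistTheory.
Variable R : comPzSemiRingType.
Implicit Types U V W : choiceType.

Lemma dist_ext U (p q : dist R U) : p =1 q -> p = q.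
Proof.
case: p q => [p pf p1] [q qf q1] /= /funext pq; move: pf p1 qf q1.
by rewrite pq => *; congr Dist; exact: Prop_irrelevance.
Qed.

Lemma finite_nz U (F : U -> R) (A : {fset U}) :
  (forall u, u \notin A -> F u = 0) -> finite_set [set u | F u != 0].
Proof.
move=> FA; apply: (finite_subfset A) => u /=.
by apply: contraNT => /FA ->.
Qed.

Definition supp U (p : dist R U) : {fset U} := fset_set [set u | p u != 0].

Lemma suppP U (p : dist R U) u : u \notin supp p -> p u = 0.
Proof.
rewrite /supp in_fset_set; last exact: dist_finite.
by rewrite notin_setE /= => /negP; rewrite negbK => /eqP.
Qed.

Lemma sum_supp U (p : dist R U) : \sum_(u <- supp p) p u = 1.
Proof. by rewrite -(fsbigTE (supp p)) ?dist_sum1//; exact: suppP. Qed.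

Lemma delta_finite U (u : U) : finite_set [set v : U | ((v == u)%:R : R) != 0].
Proof.
apply: (@finite_nz _ _ [fset u]%fset) => v.
by rewrite inE => /negbTE ->.
Qed.

Lemma delta_sum1 U (u : U) : \sum_(v \in [set: U]) ((v == u)%:R : R) = 1.
Proof.
rewrite (fsbigTE [fset u]%fset); first by rewrite big_seq_fset1 eqxx.
by move=> v; rewrite inE => /negbTE ->.
Qed.

Definition delta U (u : U) : dist R U := Dist (delta_finite u) (delta_sum1 u).

Definition push U V (g : U -> V) (p : dist R U) (v : V) : R :=
  \sum_(u \in g @^-1` [set v]) p u.

Lemma pushE U V (g : U -> V) (p : dist R U) (v : V) :
  push g p v = \sum_(u <- supp p | g u == v) p u.
Proof.
rewrite bigfs //=; last by move=> u _; exact: suppP.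
by apply: eq_fsbigl; apply/seteqP; split => u /eqP.
Qed.

Lemma push0 U V (g : U -> V) (p : dist R U) v :
  v \notin [fset g u | u in supp p]%fset -> push g p v = 0.
Proof.
move=> vn; rewrite pushE big_seq_cond big1// => u /andP[us /eqP gu].
by move: vn; rewrite -gu in_imfset.
Qed.

Lemma push_finite U V (g : U -> V) (p : dist R U) :
  finite_set [set v | push g p v != 0].
Proof. apply: finite_nz; exact: push0. Qed.

Lemma push_sum1 U V (g : U -> V) (p : dist R U) :
  \sum_(v \in [set: V]) push g p v = 1.
Proof.
rewrite (fsbigTE _ _ (@push0 _ _ g p)) -(sum_supp p).
under eq_bigr do rewrite pushE.
rewrite (exchange_big_dep xpredT)//= big_seq [RHS]big_seq.
apply: eq_bigr => u us.
rewrite big_mkcond (big_fsetD1 (g u)) ?in_imfset//= eqxx.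
rewrite big_seq big1 ?addr0// => v; rewrite !inE => /andP[+ _].
by rewrite eq_sym => /negbTE ->.
Qed.

Definition distmap U V (g : U -> V) (p : dist R U) : dist R V :=
  Dist (push_finite g p) (push_sum1 g p).

Lemma distmap_ext U V (g h : U -> V) (p : dist R U) :
  g =1 h -> distmap g p = distmap h p.
Proof. by move=> /funext ->. Qed.

Lemma distmap_sum U V (g : U -> V) (p : dist R U) (A : {fset U}) v :
  (forall u, u \notin A -> p u = 0) ->
  distmap g p v = \sum_(u <- A | g u == v) p u.
Proof.
move=> pA; rewrite bigfs //=; last by move=> u _; exact: pA.
by apply: eq_fsbigl; apply/seteqP; split => u /eqP.
Qed.

Lemma distmap_comp U V W (g : U -> V) (h : V -> W) (p : dist R U) :
  distmap h (distmap g p) = distmap (h \o g) p.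
Proof.
apply: dist_ext => w; rewrite (@distmap_sum _ _ h (distmap g p) _ w (@push0 _ _ g p)).
rewrite (distmap_sum _ _ (@suppP _ p)).
under eq_bigr do rewrite (distmap_sum _ _ (@suppP _ p)).
rewrite (exchange_big_dep (fun u => h (g u) == w))/=; last first.
  by move=> v u hv /eqP ->.
rewrite big_seq_cond [RHS]big_seq_cond.
apply: eq_bigr => u /andP[us /eqP hu].
rewrite big_mkcond (big_fsetD1 (g u)) ?in_imfset//= eqxx hu eqxx.
rewrite big_seq big1 ?addr0// => v; rewrite !inE => /andP[+ _].
by rewrite [g u == v]eq_sym => /negbTE ->; rewrite andbF.
Qed.

Lemma distmap_id U (p : dist R U) : distmap id p = p.
Proof.
apply: dist_ext => v; rewrite /= /push.
by rewrite (_ : _ @^-1` _ = [set v])// fsbig_set1.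
Qed.

Lemma distmap_delta U V (g : U -> V) (u : U) :
  distmap g (delta u) = delta (g u).
Proof.
apply: dist_ext => v; rewrite (@distmap_sum _ _ _ _ [fset u]%fset)/=.
  by rewrite big_mkcond big_seq_fset1 eqxx eq_sym; case: eqP.
by move=> w; rewrite inE => /negbTE ->.
Qed.

Lemma distmap_cst U V (v : V) (p : dist R U) :
  distmap (fun=> v) p = delta v.
Proof.
apply: dist_ext => w; rewrite (distmap_sum _ _ (@suppP _ p))/=.
rewrite [w == v]eq_sym; case: eqP => _; last by rewrite big_pred0_eq.
by rewrite sum_supp.
Qed.

Lemma distmap_inj U V (g : U -> V) (p : dist R U) (u : U) :
  injective g -> distmap g p (g u) = p u.
Proof.
move=> gi; rewrite /= /push (_ : _ @^-1` _ = [set u]) ?fsbig_set1//.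
by apply/seteqP; split => w /= => [/gi|->].
Qed.

Lemma distmap_out U V (g : U -> V) (p : dist R U) (v : V) :
  (forall u, g u <> v) -> distmap g p v = 0.
Proof. by move=> gv; rewrite /= /push fsbig1// => u /gv. Qed.

End DistTheory.

Record complex := Complex {
  vertex :> choiceType;
  simplex : {pred {fset vertex}};
  simplex0 : fset0 \in simplex;
  simplex1 : forall x, [fset x]%fset \in simplex;
  simplexS : forall s t : {fset vertex},
    (t `<=` s)%fset -> s \in simplex -> t \in simplex }.
Arguments simplex : clear implicits.

Definition simplices (S : complex) := {s : {fset S} | s \in simplex S}.
HB.instance Definition _ (S : complex) := Choice.on (simplices S).

Record scmap (G S : complex) := ScMap {
  scfun :> G -> S;
  scmapP : forall g, g \in simplex G -> (scfun @` g)%fset \in simplex S }.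

Definition star (S : complex) (s : {fset S}) : {pred {fset S}} :=
  [pred t | (t \in simplex S) && (s `<=` t)%fset].

Record bundle (G S : complex) := Bundle {
  bundle_map :> scmap G S;
  bundle_surj : forall s, s \in simplex S ->
    exists2 g, g \in simplex G & (bundle_map @` g)%fset = s;
  bundle_loc_surj : forall g, g \in simplex G -> g != fset0 ->
    forall s, s \in star (bundle_map @` g)%fset ->
    exists2 h, h \in star g & (bundle_map @` h)%fset = s;
  bundle_discrete : forall x y : G, x != y -> bundle_map x = bundle_map y ->
    [fset x; y]%fset \notin simplex G }.

Record outcomes (S : complex) := Outcomes {
  outcome :> S -> choiceType;
  outcome_nonempty : forall x, inhabited (outcome x) }.

(* [events O A] is the product of the [O x] for [x] in [A]; finite simplices
   are used through [[set` s]]. *)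
Definition events (S : complex) (O : outcomes S) (A : set S) :=
  forall x : S, A x -> O x.
HB.instance Definition _ (S : complex) (O : outcomes S) (A : set S) :=
  gen_eqMixin (events O A).
HB.instance Definition _ (S : complex) (O : outcomes S) (A : set S) :=
  gen_choiceMixin (events O A).

Definition restr (S : complex) (O : outcomes S) (A B : set S) (BA : B `<=` A)
  (e : events O A) : events O B := fun x Bx => e x (BA x Bx).

Definition fsub_set (T : choiceType) (s t : {fset T}) (h : (t `<=` s)%fset) :
  [set` t] `<=` [set` s] := fun x => fsubsetP h x.

Record emp (R : comPzSemiRingType) (S : complex) (O : outcomes S) := Emp {
  emp_dist :> forall s : simplices S, dist R (events O [set` val s]);
  emp_compat : forall (s t : simplices S) (h : (val t `<=` val s)%fset),
    distmap (restr (fsub_set h)) (emp_dist s) = emp_dist t }.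

Definition emp_noncontextual R S (O : outcomes S) (e : emp R O) :=
  exists d : dist R (events O setT), forall (s : simplices S) t,
    e s t = \sum_(u \in [set: events O setT])
              d u * delta R (restr (@subsetT _ [set` val s]) u) t.

Definition emp_contextual R S (O : outcomes S) (e : emp R O) :=
  ~ emp_noncontextual e.

Definition fiber (G S : complex) (f : scmap G S) (s : {fset S}) :=
  {g : {fset G} | (g \in simplex G) && ((f @` g)%fset == s)}.
HB.instance Definition _ (G S : complex) (f : scmap G S) (s : {fset S}) :=
  Choice.on (fiber f s).

Section Bundle.
Variables (G S : complex) (f : bundle G S).

Definition over (t : {fset S}) (g : {fset G}) : {fset G} :=
  [fset x in g | f x \in t]%fset.

Lemma over_sub t g : (over t g `<=` g)%fset.
Proof. by apply/fsubsetP => x; rewrite !inE => /andP[]. Qed.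

Lemma over_simplex t g : g \in simplex G -> over t g \in simplex G.
Proof. exact/simplexS/over_sub. Qed.

Lemma over_image t g : (t `<=` f @` g)%fset -> (f @` over t g)%fset = t.
Proof.
move=> /fsubsetP tg; apply/fsetP => x; apply/imfsetP/idP => /=.
  by move=> [y]; rewrite !inE => /andP[_ yt] ->.
move=> xt; have /imfsetP[y /= yg xy] := tg _ xt.
by exists y => //; rewrite !inE yg -xy.
Qed.

Lemma bundle_inj g : g \in simplex G -> {in g &, injective f}.
Proof.
move=> gG x y xg yg fxy; apply/eqP; apply: contraT => xy.
have := bundle_discrete xy fxy.
rewrite (simplexS _ gG)//; apply/fsubsetP => z.
by rewrite !inE => /orP[] /eqP ->.
Qed.

Lemma over_uniq g h : g \in simplex G -> (h `<=` g)%fset ->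
  h = over (f @` h)%fset g.
Proof.
move=> gG /fsubsetP hg; apply/fsetP => x; rewrite !inE.
apply/idP/andP => [xh|[xg /imfsetP[y /= yh fxy]]].
  by rewrite hg// in_imfset.
by rewrite (bundle_inj gG xg (hg _ yh) fxy).
Qed.

Lemma restrict_subproof (s t : {fset S}) (h : (t `<=` s)%fset)
    (g : fiber f s) :
  (over t (val g) \in simplex G) && ((f @` over t (val g))%fset == t).
Proof.
have /andP[gG /eqP fg] := valP g.
by rewrite over_simplex//= over_image ?fg.
Qed.

(* By [over_uniq], the only subset of [g] that is mapped onto [t]. *)
Definition restrict (s t : {fset S}) (h : (t `<=` s)%fset) (g : fiber f s) :
  fiber f t := Sub (over t (val g)) (restrict_subproof h g).

Record bemp (R : comPzSemiRingType) := BEmp {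
  bemp_dist :> forall s : simplices S, dist R (fiber f (val s));
  bemp_compat : forall (s t : simplices S) (h : (val t `<=` val s)%fset),
    distmap (restrict h) (bemp_dist s) = bemp_dist t }.

Record bsect := BSect {
  bsect_map :> scmap S G;
  bsectK : forall x, f (bsect_map x) = x }.
HB.instance Definition _ := gen_eqMixin bsect.
HB.instance Definition _ := gen_choiceMixin bsect.

Lemma bsect_fiber_subproof (u : bsect) (s : simplices S) :
  ((u @` val s)%fset \in simplex G)
    && ((f @` (u @` val s))%fset == val s).
Proof.
rewrite scmapP ?(valP s)//= -imfset_comp; apply/eqP.
rewrite -[RHS]imfset_id; apply: eq_imfset => // x /=; exact: bsectK.
Qed.

Definition bsect_fiber (u : bsect) (s : simplices S) : fiber f (val s) :=
  Sub (u @` val s)%fset (bsect_fiber_subproof u s).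

Definition bemp_noncontextual R (p : bemp R) :=
  exists d : dist R bsect, forall (s : simplices S) g,
    p s g = \sum_(u \in [set: bsect]) d u * delta R (bsect_fiber u s) g.

Definition bemp_contextual R (p : bemp R) := ~ bemp_noncontextual p.

End Bundle.

Local Notation up i := (lift ord0 i).
Local Notation wd i := (widen_ord (leqnSn _) i).

(* [up i] is [i + 1] and [wd i] is [i] in the next larger ordinal type, so
   [face_face], for instance, is d_i d_(j+1) = d_j d_i for i <= j. *)
Record sset := SSet {
  sobj :> nat -> choiceType;
  face : forall n, 'I_n.+2 -> sobj n.+1 -> sobj n;
  degen : forall n, 'I_n.+1 -> sobj n -> sobj n.+1;
  face_face : forall n (i j : 'I_n.+2) (x : sobj n.+2), (i <= j)%N ->
    face i (face (up j) x) = face j (face (wd i) x);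
  face_degen_lt : forall n (i : 'I_n.+2) (j : 'I_n.+1) (x : sobj n.+1),
    (i <= j)%N -> face (wd i) (degen (up j) x) = degen j (face i x);
  face_degen_id : forall n (j : 'I_n.+1) (x : sobj n),
    face (wd j) (degen j x) = x;
  face_degen_id1 : forall n (j : 'I_n.+1) (x : sobj n),
    face (up j) (degen j x) = x;
  face_degen_gt : forall n (i : 'I_n.+2) (j : 'I_n.+1) (x : sobj n.+1),
    (j < i)%N -> face (up i) (degen (wd j) x) = degen j (face i x);
  degen_degen : forall n (i j : 'I_n.+1) (x : sobj n), (i <= j)%N ->
    degen (wd i) (degen j x) = degen (up j) (degen i x) }.

Record smap (X Y : sset) := SMap {
  smap_fun :> forall n, X n -> Y n;
  smap_face : forall n i (x : X n.+1),
    smap_fun (face i x) = face i (smap_fun x);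
  smap_degen : forall n j (x : X n),
    smap_fun (degen j x) = degen j (smap_fun x) }.
Arguments smap_fun {X Y} _ n _.

Section SDist.
Variable R : comPzSemiRingType.

Section DistSSet.
Variable X : sset.

Definition dist_obj n : choiceType := dist R (X n).
Definition dist_face n (i : 'I_n.+2) : dist_obj n.+1 -> dist_obj n :=
  distmap (@face X n i).
Definition dist_degen n (j : 'I_n.+1) : dist_obj n -> dist_obj n.+1 :=
  distmap (@degen X n j).

Lemma dist_face_face n (i j : 'I_n.+2) (p : dist_obj n.+2) : (i <= j)%N ->
  dist_face i (dist_face (up j) p) = dist_face j (dist_face (wd i) p).
Proof.
move=> h; rewrite /dist_face !distmap_comp.
by apply: distmap_ext => x /=; rewrite face_face.
Qed.

Lemma dist_face_degen_lt n (i : 'I_n.+2) (j : 'I_n.+1) (p : dist_obj n.+1) :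
  (i <= j)%N ->
  dist_face (wd i) (dist_degen (up j) p) = dist_degen j (dist_face i p).
Proof.
move=> h; rewrite /dist_face /dist_degen !distmap_comp.
by apply: distmap_ext => x /=; rewrite face_degen_lt.
Qed.

Lemma dist_face_degen_id n (j : 'I_n.+1) (p : dist_obj n) :
  dist_face (wd j) (dist_degen j p) = p.
Proof.
rewrite /dist_face /dist_degen distmap_comp -[RHS]distmap_id.
by apply: distmap_ext => x /=; rewrite face_degen_id.
Qed.

Lemma dist_face_degen_id1 n (j : 'I_n.+1) (p : dist_obj n) :
  dist_face (up j) (dist_degen j p) = p.
Proof.
rewrite /dist_face /dist_degen distmap_comp -[RHS]distmap_id.
by apply: distmap_ext => x /=; rewrite face_degen_id1.
Qed.

Lemma dist_face_degen_gt n (i : 'I_n.+2) (j : 'I_n.+1) (p : dist_obj n.+1) :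
  (j < i)%N ->
  dist_face (up i) (dist_degen (wd j) p) = dist_degen j (dist_face i p).
Proof.
move=> h; rewrite /dist_face /dist_degen !distmap_comp.
by apply: distmap_ext => x /=; rewrite face_degen_gt.
Qed.

Lemma dist_degen_degen n (i j : 'I_n.+1) (p : dist_obj n) : (i <= j)%N ->
  dist_degen (wd i) (dist_degen j p) = dist_degen (up j) (dist_degen i p).
Proof.
move=> h; rewrite /dist_degen !distmap_comp.
by apply: distmap_ext => x /=; rewrite degen_degen.
Qed.

Definition dist_sset : sset :=
  SSet dist_face_face dist_face_degen_lt dist_face_degen_id
       dist_face_degen_id1 dist_face_degen_gt dist_degen_degen.

Lemma delta_smap_face n i (x : X n.+1) :
  delta R (face i x) = dist_face i (delta R x).
Proof. by rewrite /dist_face distmap_delta. Qed.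

Lemma delta_smap_degen n j (x : X n) :
  delta R (degen j x) = dist_degen j (delta R x).
Proof. by rewrite /dist_degen distmap_delta. Qed.

Definition delta_smap : smap X dist_sset :=
  @SMap X dist_sset (fun n x => delta R x) delta_smap_face delta_smap_degen.

End DistSSet.

Section DistSMap.
Variables (E X : sset) (g : smap E X).

Lemma dist_smap_face n i (p : dist_sset E n.+1) :
  distmap (g n) (face i p) = @dist_face X n i (distmap (g n.+1) p).
Proof.
rewrite /= /dist_face !distmap_comp.
by apply: distmap_ext => x /=; rewrite smap_face.
Qed.

Lemma dist_smap_degen n j (p : dist_sset E n) :
  distmap (g n.+1) (degen j p) = @dist_degen X n j (distmap (g n) p).
Proof.
rewrite /= /dist_degen !distmap_comp.
by apply: distmap_ext => x /=; rewrite smap_degen.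
Qed.

Definition dist_smap : smap (dist_sset E) (dist_sset X) :=
  @SMap (dist_sset E) (dist_sset X) (fun n p => distmap (g n) p)
    dist_smap_face dist_smap_degen.

Record sdist := SDist {
  sdist_map :> smap X (dist_sset E);
  sdistP : forall n (x : X n), dist_smap n (sdist_map n x) = delta_smap X n x }.

Record ssect := SSect {
  ssect_map :> smap X E;
  ssectK : forall n (x : X n), g n (ssect_map n x) = x }.
HB.instance Definition _ := gen_eqMixin ssect.
HB.instance Definition _ := gen_choiceMixin ssect.

Definition sdist_noncontextual (p : sdist) :=
  exists d : dist R ssect, forall n (x : X n) (y : E n),
    (p n x : dist R (E n)) y
      = \sum_(u \in [set: ssect]) d u * delta R (u n x) y.

Definition sdist_contextual (p : sdist) := ~ sdist_noncontextual p.

End DistSMap.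
End SDist.

Section EventBundle.
Variables (S : complex) (O : outcomes S).

Definition event_vertex : choiceType := {x : S & O x}.

Definition event x (o : O x) : event_vertex := Tagged (fun z => O z : Type) o.

Definition graph (s : {fset S}) (t : events O [set` s]) :
    {fset event_vertex} :=
  [fset event (t (val x) (valP x)) | x : s]%fset.

Lemma graphP (s : {fset S}) (t : events O [set` s]) (y : event_vertex) :
  reflect (exists h : tag y \in s, y = event (t (tag y) h)) (y \in graph t).
Proof.
apply: (iffP idP) => [/imfsetP[x /= _ ->]|[h yE]] /=.
  by exists (valP x).
by apply/imfsetP; exists [` h]%fset => //=; rewrite [LHS]yE; congr (event (t _ _));
  exact: bool_irrelevance.
Qed.

Lemma mem_graph (s : {fset S}) (t : events O [set` s]) x (h : x \in s) :
  event (t x h) \in graph t.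
Proof. by apply/graphP; exists h. Qed.

Lemma graph_fun (s : {fset S}) (t : events O [set` s]) (y z : event_vertex) :
  y \in graph t -> z \in graph t -> tag y = tag z -> y = z.
Proof.
move=> /graphP[h yE] /graphP[k zE] e; rewrite [LHS]yE [RHS]zE.
move: h k {yE zE}; rewrite e => h k.
by congr (event (t _ _)); exact: bool_irrelevance.
Qed.

Lemma graph_image (s : {fset S}) (t : events O [set` s]) :
  ((fun y : event_vertex => tag y) @` graph t)%fset = s.
Proof.
apply/fsetP => x; apply/imfsetP/idP => /= [[y /graphP[h _] ->]//|xs].
by exists (event (t x xs)) => //; exact: mem_graph.
Qed.

Lemma graph_inj (s : {fset S}) : injective (@graph s).
Proof.
move=> t u tu; apply: functional_extensionality_dep => x.
apply: functional_extensionality_dep => h.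
have := mem_graph t h; rewrite tu => /graphP[/= h'].
move=> /eqP; rewrite eq_Tagged /= => /eqP ->.
by congr (u x _); exact: bool_irrelevance.
Qed.

Lemma graph_sub (s r : {fset S}) (t : events O [set` s]) (h : (r `<=` s)%fset) :
  (graph (restr (fsub_set h) t) `<=` graph t)%fset.
Proof.
by apply/fsubsetP => y /graphP[hy yE]; apply/graphP; exists (fsub_set h hy).
Qed.

Definition event_simplex : {pred {fset event_vertex}} := fun g =>
  `[< exists2 s : {fset S}, s \in simplex S &
      exists t : events O [set` s], g = graph t >].

Lemma event_simplexP (g : {fset event_vertex}) : g \in event_simplex <->
  exists2 s : {fset S}, s \in simplex S &
    exists t : events O [set` s], g = graph t.
Proof. by split=> [/asboolP|?]; last exact/asboolP. Qed.

Lemma event_simplex0 : fset0 \in event_simplex.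
Proof.
apply/event_simplexP; exists fset0; first exact: simplex0.
exists (fun x (h : x \in fset0) =>
  False_rect (O x) (notF (etrans (esym (in_fset0 x)) h))).
by apply/fsetP => y; rewrite inE; apply/esym/negP => /graphP[].
Qed.

Lemma event_simplex1 y : [fset y]%fset \in event_simplex.
Proof.
case: y => x o; apply/event_simplexP; exists [fset x]%fset.
  exact: simplex1.
pose t : events O [set` [fset x]%fset] :=
  fun z h => ecast w (O w) (esym (elimT (fset1P _ _) h)) o.
exists t; apply/fsetP => y; rewrite inE; apply/eqP/graphP => /= [->|[]].
  exists (fset11 x); rewrite /t /=.
  by rewrite (eq_irrelevance (esym _) erefl).
by case: y => z o' /= h ->; rewrite /t; move: (elimT _ h) => /= e; subst z.
Qed.

Lemma event_simplexS (g h : {fset event_vertex}) :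
  (h `<=` g)%fset -> g \in event_simplex -> h \in event_simplex.
Proof.
move=> /fsubsetP hg /event_simplexP[s sS [t gE]]; subst g.
have rs : ((fun y : event_vertex => tag y) @` h `<=` s)%fset.
  apply/fsubsetP => x /imfsetP[y /= yh ->].
  by have /graphP[] := hg _ yh.
apply/event_simplexP; exists ((fun y : event_vertex => tag y) @` h)%fset.
  exact: simplexS rs sS.
exists (restr (fsub_set rs) t); apply/fsetP => y; apply/idP/graphP => [yh|].
  have /graphP[k yE] := hg _ yh.
  exists (in_imfset imfset_key (fun y : event_vertex => tag y) yh).
  by rewrite [LHS]yE; congr (event (t _ _)); exact: bool_irrelevance.
move=> [k yE]; have /imfsetP[z /= zh zy] := k.
suff -> : y = z by [].
apply: (@graph_fun s t) => //; last exact: hg.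
by apply/graphP; exists (fsub_set rs k).
Qed.

Definition event_complex : complex :=
  Complex event_simplex0 event_simplex1 event_simplexS.

Lemma event_map_subproof (g : {fset event_complex}) :
  g \in simplex event_complex ->
  ((fun y : event_complex => tag y) @` g)%fset \in simplex S.
Proof. by move=> /event_simplexP[s sS [t ->]]; rewrite graph_image. Qed.

Definition event_map : scmap event_complex S := ScMap event_map_subproof.

Lemma event_surj (s : {fset S}) : s \in simplex S ->
  exists2 g, g \in simplex event_complex & (event_map @` g)%fset = s.
Proof.
move=> sS.
have ex x : exists o : O x, True by case: (outcome_nonempty O x) => o; exists o.
pose t : events O [set` s] := fun x _ => projT1 (cid (ex x)).
exists (graph t); last exact: graph_image.
by apply/event_simplexP; exists s => //; exists t.
Qed.

Lemma event_loc_surj (g : {fset event_complex}) :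
  g \in simplex event_complex -> g != fset0 ->
  forall s, s \in star (event_map @` g)%fset ->
  exists2 h, h \in star g & (event_map @` h)%fset = s.
Proof.
move=> /event_simplexP[r rS [t gE]] _ s; rewrite {}gE graph_image inE.
move=> /andP[sS rs].
have ex x : exists o : O x, forall h : x \in r, o = t x h.
  case: (pselect (x \in r)) => [h|nh].
    by exists (t x h) => h'; congr (t x _); exact: bool_irrelevance.
  by case: (outcome_nonempty O x) => o; exists o => h; case: nh.
pose u : events O [set` s] := fun x _ => projT1 (cid (ex x)).
exists (graph u); last exact: graph_image.
rewrite inE; apply/andP; split.
  by apply/event_simplexP; exists s => //; exists u.
suff <- : restr (fsub_set rs) u = t by exact: graph_sub.
apply: functional_extensionality_dep => x.
apply: functional_extensionality_dep => h.
by rewrite /restr /u; case: cid.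
Qed.

Lemma event_discrete (x y : event_complex) :
  x != y -> event_map x = event_map y ->
  [fset x; y]%fset \notin simplex event_complex.
Proof.
move=> xy fxy; apply/negP => /event_simplexP[s sS [t gE]].
case/eqP: xy; apply: (@graph_fun s t) => //; rewrite -gE.
  exact: fset21.
exact: fset22.
Qed.

Definition event_bundle : bundle event_complex S :=
  Bundle event_surj event_loc_surj event_discrete.

Lemma graph_fiber_subproof (s : simplices S) (t : events O [set` val s]) :
  (graph t \in simplex event_complex)
    && ((event_bundle @` graph t)%fset == val s).
Proof.
apply/andP; split; last by rewrite graph_image.
by apply/event_simplexP; exists (val s); [exact: valP|exists t].
Qed.

Definition graph_fiber (s : simplices S) (t : events O [set` val s]) :
  fiber event_bundle (val s) := Sub (graph t) (graph_fiber_subproof t).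

Lemma fiber_event_subproof (s : {fset S}) (g : fiber event_bundle s) x :
  x \in s -> exists o : O x, event o \in val g.
Proof.
have /andP[_ /eqP /fsetP /(_ x) gx] := valP g.
by rewrite /= -gx => /imfsetP[[y o] /= yg ->]; exists o.
Qed.

(* A simplex of [event_complex] lying over [s] is the graph of exactly one
   event over [s], which [fiber_event] recovers; see [graph_fiberK]. *)
Definition fiber_event (s : {fset S}) (g : fiber event_bundle s) :
  events O [set` s] := fun x h => projT1 (cid (fiber_event_subproof g h)).

Lemma graph_fiberK (s : simplices S) :
  cancel (@graph_fiber s) (@fiber_event (val s)).
Proof.
move=> t; apply: functional_extensionality_dep => x.
apply: functional_extensionality_dep => h.
rewrite /fiber_event; case: cid => o /= og.
have /eqP := graph_fun og (mem_graph t h) erefl.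
by rewrite eq_Tagged => /eqP.
Qed.

Lemma fiber_eventK (s : simplices S) :
  cancel (@fiber_event (val s)) (@graph_fiber s).
Proof.
move=> g; suff [t <-] : exists t, graph_fiber t = g by rewrite graph_fiberK.
have /andP[/event_simplexP[r rS [t gE]] /eqP gs] := valP g.
rewrite gE graph_image in gs; subst r.
by exists t; apply: val_inj.
Qed.

Section Eta.
Variables (R : comPzSemiRingType) (e : emp R O).

Definition eta_fun (s : simplices S) (g : fiber event_bundle (val s)) : R :=
  e s (fiber_event g).

Lemma eta_funE s : @eta_fun s = distmap (@graph_fiber s) (e s).
Proof.
apply: functional_extensionality_dep => g.
by rewrite -{2}[g]fiber_eventK distmap_inj//; exact: can_inj (@graph_fiberK s).
Qed.

Lemma eta_finite s : finite_set [set g | @eta_fun s g != 0].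
Proof. by rewrite eta_funE; exact: dist_finite. Qed.

Lemma eta_sum1 s : \sum_(g \in [set: fiber event_bundle (val s)]) eta_fun g = 1.
Proof. by rewrite eta_funE; exact: dist_sum1. Qed.

Definition eta_dist s := Dist (@eta_finite s) (@eta_sum1 s).

Lemma eta_distE s : eta_dist s = distmap (@graph_fiber s) (e s).
Proof. by apply: dist_ext => g /=; rewrite eta_funE. Qed.

Lemma eta_compat (s r : simplices S) (h : (val r `<=` val s)%fset) :
  distmap (restrict h) (eta_dist s) = eta_dist r.
Proof.
rewrite !eta_distE -(emp_compat e h) !distmap_comp.
apply: distmap_ext => t /=; apply: val_inj => /=.
rewrite [RHS](@over_uniq _ _ event_bundle (graph t)).
- by rewrite graph_image.
- by have /andP[] := valP (graph_fiber t).
- exact: graph_sub.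
Qed.

Definition eta : bemp event_bundle R := BEmp eta_compat.

End Eta.
End EventBundle.

Section SeqFaces.
Variable T : choiceType.
Implicit Types (s : seq {fset T}) (i j : nat).

Definition funion s : {fset T} := (\bigcup_(x <- s) x)%fset.

Definition seq_face i s : seq {fset T} :=
  if i == 0%N then behead s
  else if i == size s then take i.-1 s
  else take i.-1 s
    ++ (nth fset0 s i.-1 `|` nth fset0 s i)%fset :: drop i.+1 s.

Definition seq_degen j s : seq {fset T} := take j s ++ fset0 :: drop j s.

(* A recursive form of [seq_face], on which the identities are proved. *)
Fixpoint rec_face i s : seq {fset T} :=
  match i, s with
  | 0, _ => behead s
  | _.+1, [::] => [::]
  | i'.+1, a :: s' =>
    match i', s' with
    | 0, b :: t => (a `|` b)%fset :: t
    | 0, [::] => [::]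
    | _.+1, _ => a :: rec_face i' s'
    end
  end.

#[global] Arguments rec_face : simpl nomatch.
#[global] Arguments seq_degen : simpl never.

Lemma seq_faceE i s : (i <= size s)%N -> seq_face i s = rec_face i s.
Proof.
rewrite /seq_face; elim: s i => [|a s IH] [|[|i]]//=; rewrite ?ltnS.
  by case: s {IH} => [|b t] //=; rewrite drop0.
move=> h; have := IH i.+1 h; rewrite eqSS /= => <-.
by case: ifP.
Qed.

Lemma size_seq_face i s : (i <= size s)%N -> size (seq_face i s) = (size s).-1.
Proof.
move=> h; rewrite seq_faceE//; elim: s i h => [|a s IH] [|[|i]]//=.
  by case: s {IH} => [|b t].
by rewrite ltnS => h; rewrite IH//; case: s h {IH}.
Qed.

Lemma size_seq_degen j s : size (seq_degen j s) = (size s).+1.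
Proof. by rewrite size_cat /= addnS -size_cat cat_take_drop. Qed.

Lemma seq_degenS j a s : seq_degen j.+1 (a :: s) = a :: seq_degen j s.
Proof. by []. Qed.

Lemma seq_degen0 s : seq_degen 0 s = fset0 :: s.
Proof. by rewrite /seq_degen take0 drop0. Qed.

Lemma rec_face_face i j s : (i <= j)%N -> (j < size s)%N ->
  rec_face i (rec_face j.+1 s) = rec_face j (rec_face i s).
Proof.
elim: s i j => [|a s IH] [|[|i]] [|j]//=; rewrite ?ltnS.
- by case: s {IH}.
- move=> _; case: s {IH} => [|b t]//= _.
  by case: j => [|j]//=; case: t => [|c u]//=; rewrite fsetUA.
- by case: j => // j ij js /=; rewrite IH.
Qed.

Lemma rec_face_degen_lt i j s : (i <= j)%N -> (j < size s)%N ->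
  rec_face i (seq_degen j.+1 s) = seq_degen j (rec_face i s).
Proof.
elim: s i j => [|a s IH] [|[|i]] [|j]//=; rewrite ?ltnS.
- by case: s {IH} => [|b t]//= _; rewrite seq_degenS.
- by move=> ij js; rewrite !seq_degenS -IH.
Qed.

Lemma rec_face_degen_id j s : (j <= size s)%N ->
  rec_face j (seq_degen j s) = s.
Proof.
elim: s j => [|a s IH] [|[|j]]//=; rewrite ?ltnS.
- by rewrite seq_degenS seq_degen0 /= fsetU0.
- by move=> h; congr cons; exact: (IH j.+1).
Qed.

Lemma rec_face_degen_id1 j s : (j <= size s)%N ->
  rec_face j.+1 (seq_degen j s) = s.
Proof.
elim: s j => [|a s IH] [|j]//=; rewrite ?ltnS.
- by rewrite fset0U.
- by move=> h; congr cons; exact: IH.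
Qed.

Lemma rec_face_degen_gt i j s : (j < i <= size s)%N ->
  rec_face i.+1 (seq_degen j s) = seq_degen j (rec_face i s).
Proof.
elim: s i j => [|a s IH] [|[|i]] [|j]//; rewrite ?seq_degen0//.
by move=> h; congr cons; exact: (IH i.+1).
Qed.

Lemma seq_degen_degen i j s : (i <= j <= size s)%N ->
  seq_degen i (seq_degen j s) = seq_degen j.+1 (seq_degen i s).
Proof.
elim: s i j => [|a s IH] [|i] [|j]//=; rewrite ?ltnS ?seq_degen0//.
by move=> h; rewrite !seq_degenS IH.
Qed.

Lemma funion_cons a s : funion (a :: s) = (a `|` funion s)%fset.
Proof. by rewrite /funion big_cons. Qed.

Lemma funion_sub x s : x \in s -> (x `<=` funion s)%fset.
Proof.
elim: s => // a s IH; rewrite inE funion_cons => /orP[/eqP ->|/IH h].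
  exact: fsubsetUl.
exact: fsubset_trans h (fsubsetUr _ _).
Qed.

Lemma funion_rec_face i s : (funion (rec_face i s) `<=` funion s)%fset.
Proof.
elim: s i => [|a s IH] [|[|i]]//=.
- by rewrite funion_cons fsubsetUr.
- case: s {IH} => [|b t]; first by rewrite {1}/funion big_nil fsub0set.
  by rewrite !funion_cons fsetUA.
- by rewrite !funion_cons fsetUS.
Qed.

Lemma funion_seq_degen j s : funion (seq_degen j s) = funion s.
Proof.
elim: s j => [|a s IH] [|j]; last by rewrite seq_degenS !funion_cons IH.
- by rewrite seq_degen0 funion_cons fset0U.
- by rewrite -[seq_degen _ _]/[:: fset0] funion_cons fset0U.
- by rewrite seq_degen0 funion_cons fset0U.
Qed.

End SeqFaces.

Section SeqMap.
Variables (T U : choiceType) (h : {fset T} -> {fset U}).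
Hypothesis h0 : h fset0 = fset0.
Hypothesis hU : forall a b, h (a `|` b)%fset = (h a `|` h b)%fset.

Lemma map_rec_face i s : map h (rec_face i s) = rec_face i (map h s).
Proof.
elim: s i => [|a s IH] [|[|i]]//=; last by rewrite IH.
by case: s {IH} => //= b t; rewrite hU.
Qed.

Lemma map_seq_degen j s : map h (seq_degen j s) = seq_degen j (map h s).
Proof. by rewrite /seq_degen map_cat /= h0 map_take map_drop. Qed.

Lemma funion_map s : funion (map h s) = h (funion s).
Proof.
elim: s => [|a s IH]; first by rewrite /funion !big_nil h0.
by rewrite /= !funion_cons IH hU.
Qed.

End SeqMap.

Section Nerve.
Variable S : complex.

Definition nerve_obj n : choiceType :=
  {t : n.-tuple {fset S} |
     all [in simplex S] t && (funion t \in simplex S)}.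

Lemma nerve_subproof (n : nat) (s : seq {fset S}) (hs : size s == n) :
  funion s \in simplex S ->
  all [in simplex S] (Tuple hs) && (funion (Tuple hs) \in simplex S).
Proof.
move=> us; rewrite us andbT; apply/allP => x /= xs.
exact: simplexS (funion_sub xs) us.
Qed.

Definition mk_nerve (n : nat) (s : seq {fset S}) (hs : size s == n)
  (us : funion s \in simplex S) : nerve_obj n :=
  exist _ (Tuple hs) (nerve_subproof hs us).

Definition nerve_seq n (x : nerve_obj n) : seq {fset S} := val (val x).

Lemma nerve_eq n (x y : nerve_obj n) : nerve_seq x = nerve_seq y -> x = y.
Proof. by move=> xy; do 2![apply: val_inj]. Qed.

Lemma size_nerve n (x : nerve_obj n) : size (nerve_seq x) = n.
Proof. exact: size_tuple. Qed.

Lemma nerve_funion n (x : nerve_obj n) : funion (nerve_seq x) \in simplex S.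
Proof. by have /andP[] := valP x. Qed.

Lemma nerve_face_size n (i : 'I_n.+2) (x : nerve_obj n.+1) :
  size (seq_face i (nerve_seq x)) == n.
Proof. by rewrite size_seq_face size_nerve// -ltnS. Qed.

Lemma nerve_face_funion n (i : 'I_n.+2) (x : nerve_obj n.+1) :
  funion (seq_face i (nerve_seq x)) \in simplex S.
Proof.
rewrite seq_faceE ?size_nerve -1?ltnS//.
exact: simplexS (funion_rec_face _ _) (nerve_funion x).
Qed.

Definition nerve_face n (i : 'I_n.+2) (x : nerve_obj n.+1) : nerve_obj n :=
  mk_nerve (nerve_face_size i x) (nerve_face_funion i x).

Lemma nerve_degen_size n (j : 'I_n.+1) (x : nerve_obj n) :
  size (seq_degen j (nerve_seq x)) == n.+1.
Proof. by rewrite size_seq_degen size_nerve. Qed.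

Lemma nerve_degen_funion n (j : 'I_n.+1) (x : nerve_obj n) :
  funion (seq_degen j (nerve_seq x)) \in simplex S.
Proof. by rewrite funion_seq_degen nerve_funion. Qed.

Definition nerve_degen n (j : 'I_n.+1) (x : nerve_obj n) : nerve_obj n.+1 :=
  mk_nerve (nerve_degen_size j x) (nerve_degen_funion j x).

Lemma nerve_faceE n (i : 'I_n.+2) (x : nerve_obj n.+1) :
  nerve_seq (nerve_face i x) = rec_face i (nerve_seq x).
Proof. by rewrite -seq_faceE// size_nerve -ltnS. Qed.

Lemma nerve_degenE n (j : 'I_n.+1) (x : nerve_obj n) :
  nerve_seq (nerve_degen j x) = seq_degen j (nerve_seq x).
Proof. by []. Qed.

Lemma nerve_face_face n (i j : 'I_n.+2) (x : nerve_obj n.+2) : (i <= j)%N ->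
  nerve_face i (nerve_face (up j) x) = nerve_face j (nerve_face (wd i) x).
Proof.
move=> ij; apply: nerve_eq; rewrite !nerve_faceE lift0.
by rewrite rec_face_face// size_nerve.
Qed.

Lemma nerve_face_degen_lt n (i : 'I_n.+2) (j : 'I_n.+1) (x : nerve_obj n.+1) :
  (i <= j)%N ->
  nerve_face (wd i) (nerve_degen (up j) x) = nerve_degen j (nerve_face i x).
Proof.
move=> ij; apply: nerve_eq.
rewrite nerve_degenE !nerve_faceE nerve_degenE lift0.
by rewrite rec_face_degen_lt// size_nerve.
Qed.

Lemma nerve_face_degen_id n (j : 'I_n.+1) (x : nerve_obj n) :
  nerve_face (wd j) (nerve_degen j x) = x.
Proof.
apply: nerve_eq; rewrite nerve_faceE nerve_degenE.
by rewrite rec_face_degen_id// size_nerve; exact: (ltn_ord j).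
Qed.

Lemma nerve_face_degen_id1 n (j : 'I_n.+1) (x : nerve_obj n) :
  nerve_face (up j) (nerve_degen j x) = x.
Proof.
apply: nerve_eq; rewrite nerve_faceE nerve_degenE lift0.
by rewrite rec_face_degen_id1// size_nerve; exact: (ltn_ord j).
Qed.

Lemma nerve_face_degen_gt n (i : 'I_n.+2) (j : 'I_n.+1) (x : nerve_obj n.+1) :
  (j < i)%N ->
  nerve_face (up i) (nerve_degen (wd j) x) = nerve_degen j (nerve_face i x).
Proof.
move=> ji; apply: nerve_eq.
rewrite nerve_degenE !nerve_faceE nerve_degenE lift0.
by rewrite rec_face_degen_gt// size_nerve; apply/andP; split=> //; exact: (ltn_ord i).
Qed.

Lemma nerve_degen_degen n (i j : 'I_n.+1) (x : nerve_obj n) : (i <= j)%N ->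
  nerve_degen (wd i) (nerve_degen j x) = nerve_degen (up j) (nerve_degen i x).
Proof.
move=> ij; apply: nerve_eq; rewrite !nerve_degenE lift0.
by rewrite seq_degen_degen// size_nerve; apply/andP; split=> //; exact: (ltn_ord j).
Qed.

Definition nerve : sset :=
  SSet nerve_face_face nerve_face_degen_lt nerve_face_degen_id
       nerve_face_degen_id1 nerve_face_degen_gt nerve_degen_degen.

End Nerve.

Section NerveMap.
Variables (G S : complex) (f : scmap G S).

Let img (g : {fset G}) : {fset S} := (f @` g)%fset.

Lemma nerve_map_size n (y : nerve_obj G n) : size (map img (nerve_seq y)) == n.
Proof. by rewrite size_map size_nerve. Qed.

Lemma nerve_map_funion n (y : nerve_obj G n) :
  funion (map img (nerve_seq y)) \in simplex S.
Proof.
rewrite funion_map; last exact: imfsetU; last exact: imfset0.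
exact/scmapP/nerve_funion.
Qed.

Definition nerve_map_fun n (y : nerve G n) : nerve S n :=
  mk_nerve (nerve_map_size y) (nerve_map_funion y).

Lemma nerve_map_face n i (y : nerve G n.+1) :
  nerve_map_fun (face i y) = face i (nerve_map_fun y).
Proof.
apply: nerve_eq; rewrite [RHS]nerve_faceE /nerve_seq /=.
rewrite -map_rec_face; last exact: imfsetU.
by rewrite -[in RHS]nerve_faceE.
Qed.

Lemma nerve_map_degen n j (y : nerve G n) :
  nerve_map_fun (degen j y) = degen j (nerve_map_fun y).
Proof.
apply: nerve_eq; rewrite /nerve_seq /= map_seq_degen//; exact: imfset0.
Qed.

Definition nerve_map : smap (nerve G) (nerve S) :=
  @SMap (nerve G) (nerve S) nerve_map_fun nerve_map_face nerve_map_degen.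

End NerveMap.

Section Zeta.
Variables (G S : complex) (f : bundle G S).

Definition nerve_union (K : complex) n (x : nerve K n) : simplices K :=
  Sub (funion (val (val x))) (nerve_funion x).

Lemma nerve_fiber_subproof n (x : nerve S n) (y : nerve G n) :
  (forall i, (f @` tnth (val y) i)%fset = tnth (val x) i) ->
  (val (nerve_union y) \in simplex G)
    && ((f @` val (nerve_union y))%fset == val (nerve_union x)).
Proof.
move=> yx; rewrite (valP (nerve_union y)) /=.
rewrite -(@funion_map _ _ (fun g : {fset G} => f @` g)%fset); first last.
- exact: imfsetU.
- exact: imfset0.
apply/eqP; congr funion.
have yxE : map_tuple (fun g : {fset G} => f @` g)%fset (val y) = val x.
  by apply: eq_from_tnth => i; rewrite tnth_map.
exact: (congr1 val yxE).
Qed.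

Definition nerve_fiber n (x : nerve S n) (y : nerve G n)
    (yx : forall i, (f @` tnth (val y) i)%fset = tnth (val x) i) :
  fiber f (val (nerve_union x)) :=
  Sub (val (nerve_union y)) (nerve_fiber_subproof yx).

(* The bijection from the fibre of [f] over the union of [x] to the fibre of
   [nerve_map f] over [x]. *)
Lemma split_size n (x : nerve S n) (g : {fset G}) :
  size (map (fun t => over f t g) (nerve_seq x)) == n.
Proof. by rewrite size_map size_nerve. Qed.

Lemma over0 (g : {fset G}) : over f fset0 g = fset0.
Proof. by apply/fsetP => z; rewrite !inE andbF. Qed.

Lemma overU (g : {fset G}) a b :
  over f (a `|` b)%fset g = (over f a g `|` over f b g)%fset.
Proof. by apply/fsetP => z; rewrite !inE andb_orr. Qed.

Lemma funion_over (g : {fset G}) (r : seq {fset S}) :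
  funion (map (fun t => over f t g) r) = over f (funion r) g.
Proof.
by apply: (@funion_map _ _ (fun t => over f t g)); [exact: over0|exact: overU].
Qed.

Lemma split_funion n (x : nerve S n) (s : {fset S}) (g : fiber f s) :
  funion (map (fun t => over f t (val g)) (nerve_seq x)) \in simplex G.
Proof.
rewrite (funion_over (val g)); apply: over_simplex.
by have /andP[] := valP g.
Qed.

Definition split n (x : nerve S n) (s : {fset S}) (g : fiber f s) : nerve G n :=
  mk_nerve (split_size x (val g)) (split_funion x g).

Lemma over_self (s : {fset S}) (g : fiber f s) : over f s (val g) = val g.
Proof.
have /andP[gG /eqP fg] := valP g.
by rewrite -{1}fg -over_uniq.
Qed.

Lemma split_inj n (x : nerve S n) :
  injective (@split n x (val (nerve_union x))).
Proof.
move=> g h /(congr1 (fun y => funion (nerve_seq y))).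
rewrite /nerve_seq /= !funion_over.
by rewrite !over_self => /val_inj.
Qed.

Lemma nerve_tnthP (K : complex) n (x : nerve K n) i :
  (tnth (val x) i `<=` val (nerve_union x))%fset.
Proof. by apply: funion_sub; exact: mem_tnth. Qed.

Lemma split_over n (x : nerve S n) (g : fiber f (val (nerve_union x))) i :
  (f @` tnth (val (split x g)) i)%fset = tnth (val x) i.
Proof.
have -> : val (split x g) = map_tuple (fun t => over f t (val g)) (val x).
  exact: val_inj.
rewrite tnth_map over_image//; have /andP[_ /eqP ->] := valP g.
exact: nerve_tnthP.
Qed.

Lemma split_fiber n (x : nerve S n) (y : nerve G n)
    (yx : forall i, (f @` tnth (val y) i)%fset = tnth (val x) i) :
  split x (nerve_fiber yx) = y.
Proof.
apply: val_inj; apply: eq_from_tnth => i.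
have -> : val (split x (nerve_fiber yx))
    = map_tuple (fun t => over f t (val (nerve_union y))) (val x).
  exact: val_inj.
rewrite tnth_map -yx -over_uniq//; first exact: valP (nerve_union y).
exact: nerve_tnthP.
Qed.

Variables (R : comPzSemiRingType) (p : bemp f R).

Definition zeta_fun n (x : nerve S n) (y : nerve G n) : R :=
  if pselect (forall i, (f @` tnth (val y) i)%fset = tnth (val x) i) is left yx
  then p (nerve_union x) (nerve_fiber yx) else 0.

Lemma zeta_funE n (x : nerve S n) :
  zeta_fun x = distmap (@split n x _) (p (nerve_union x)).
Proof.
apply: functional_extensionality_dep => y; rewrite /zeta_fun.
case: pselect => [yx|nyx].
  by rewrite -[in RHS](split_fiber yx) distmap_inj//; exact: split_inj.
by rewrite distmap_out// => g gy; apply: nyx => i; rewrite -gy split_over.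
Qed.

Lemma zeta_finite n (x : nerve S n) : finite_set [set y | zeta_fun x y != 0].
Proof. by rewrite zeta_funE; exact: dist_finite. Qed.

Lemma zeta_sum1 n (x : nerve S n) :
  \sum_(y \in [set: nerve G n]) zeta_fun x y = 1.
Proof. by rewrite zeta_funE; exact: dist_sum1. Qed.

Definition zeta_dist n (x : nerve S n) : dist R (nerve G n) :=
  Dist (zeta_finite x) (zeta_sum1 x).

Lemma zeta_distE n (x : nerve S n) :
  zeta_dist x = distmap (@split n x _) (p (nerve_union x)).
Proof. by apply: dist_ext => y /=; rewrite zeta_funE. Qed.

Lemma map_over_restrict (s t : {fset S}) (h : (t `<=` s)%fset) (g : fiber f s)
    (r : seq {fset S}) : (funion r `<=` t)%fset ->
  map (fun u => over f u (val (restrict h g))) r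
    = map (fun u => over f u (val g)) r.
Proof.
move=> rt; apply/eq_in_map => u ur; apply/fsetP => z; rewrite !inE.
rewrite -andbA; congr andb; apply/andP/idP => [[]//|zu]; split => //.
exact: (fsubsetP rt) _ (fsubsetP (funion_sub ur) _ zu).
Qed.

Lemma zeta_face n i (x : nerve S n.+1) :
  zeta_dist (face i x) = @dist_face R (nerve G) n i (zeta_dist x).
Proof.
have h : (val (nerve_union (face i x)) `<=` val (nerve_union x))%fset.
  rewrite [val (nerve_union (face i x))](_ :
    _ = funion (nerve_seq (nerve_face i x)))// nerve_faceE.
  exact: funion_rec_face.
rewrite /dist_face !zeta_distE -(bemp_compat p h) !distmap_comp.
apply: distmap_ext => g; apply: nerve_eq.
rewrite [RHS]nerve_faceE.
transitivity (map (fun t => over f t (val g)) (nerve_seq (nerve_face i x))).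
  exact: (map_over_restrict h g (fsubset_refl _)).
rewrite nerve_faceE.
apply: (@map_rec_face _ _ (fun t => over f t (val g))); exact: overU.
Qed.

Lemma zeta_degen n j (x : nerve S n) :
  zeta_dist (degen j x) = @dist_degen R (nerve G) n j (zeta_dist x).
Proof.
have h : (val (nerve_union (degen j x)) `<=` val (nerve_union x))%fset.
  by rewrite /= funion_seq_degen.
rewrite /dist_degen !zeta_distE -(bemp_compat p h) !distmap_comp.
apply: distmap_ext => g; apply: nerve_eq.
rewrite [RHS]nerve_degenE.
transitivity (map (fun t => over f t (val g)) (nerve_seq (nerve_degen j x))).
  exact: (map_over_restrict h g (fsubset_refl _)).
rewrite nerve_degenE.
apply: (@map_seq_degen _ _ (fun t => over f t (val g))); exact: over0.
Qed.

Definition zeta_smap : smap (nerve S) (dist_sset R (nerve G)) :=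
  @SMap (nerve S) (dist_sset R (nerve G)) zeta_dist zeta_face zeta_degen.

Lemma zeta_smapP n (x : nerve S n) :
  dist_smap R (nerve_map f) n (zeta_smap n x) = delta_smap R (nerve S) n x.
Proof.
rewrite /= zeta_distE distmap_comp -(distmap_cst x (p (nerve_union x))).
apply: distmap_ext => g; apply: val_inj; apply: eq_from_tnth => i.
rewrite -(split_over g i).
have -> : val ((nerve_map f n \o split x (s:=_)) g)
    = map_tuple (fun h : {fset G} => f @` h)%fset (val (split x g)).
  exact: val_inj.
by rewrite tnth_map.
Qed.

Definition zeta : sdist R (nerve_map f) := SDist zeta_smapP.

End Zeta.

(* Main.v *)
Require Import Defs.
From mathcomp Require Import all_boot all_order all_algebra.
From mathcomp Require Import finmap.
From mathcomp Require Import boolp classical_sets fsbigop.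

(* Both comparison maps are push-forwards along injections, and in both cases
   the global objects correspond.  A global event is a section of the event
   bundle.  A section [u] of the nerve map picks over each simplex [s] (a
   1-simplex of the nerve) a simplex [ssect_edge u s] over [s]; the 2-simplices
   make this choice monotone, so its values on vertices, singletons by
   discreteness, assemble to a section of the bundle, which determines [u] on
   the 1-simplices since subsimplices are determined by their images. *)

Set Implicit Arguments.
Unset Strict Implicit.
Unset Printing Implicit Defensive.

Import GRing.Theory.
Local Open Scope fset_scope.
Local Open Scope classical_set_scope.
Local Open Scope ring_scope.

(** A mixture of point masses is a push-forward. This turns each definition of non-contextuality
    into an equation between distributions, where functoriality of [distmap] applies. *)
Lemma distmap_mixture (R : comPzSemiRingType) (U V : choiceType) (g : U -> V)
    (d : dist R U) (v : V) :
  \sum_(u \in [set: U]) d u * delta R (g u) v = distmap g d v.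
Proof.
rewrite (fsbigTE (supp d)); last by move=> u /suppP ->; rewrite mul0r.
rewrite (distmap_sum _ _ (@suppP _ _ d)) [RHS]big_mkcond.
apply: eq_bigr => u _ /=.
by rewrite eq_sym; case: eqP; rewrite ?mulr1 ?mulr0.
Qed.

(** * Non-contextuality as push-forward from global sections *)

Section Noncontextual.
Variable R : comPzSemiRingType.

Lemma emp_noncontextualP (S : complex) (O : outcomes S) (e : emp R O) :
  emp_noncontextual e <->
  exists d : dist R (events O setT), forall s : simplices S,
    e s = distmap (restr (@subsetT _ [set` val s])) d.
Proof.
split=> -[d de]; exists d => s; last by move=> t; rewrite distmap_mixture de.
by apply: dist_ext => t; rewrite de distmap_mixture.
Qed.

Lemma bemp_noncontextualP (G S : complex) (f : bundle G S) (p : bemp f R) :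
  bemp_noncontextual p <->
  exists d : dist R (bsect f), forall s : simplices S,
    p s = distmap (fun u => bsect_fiber u s) d.
Proof.
split=> -[d dp]; exists d => s.
  by apply: dist_ext => g; rewrite dp (distmap_mixture (fun u => bsect_fiber u s)).
by move=> g; rewrite (distmap_mixture (fun u => bsect_fiber u s)) dp.
Qed.

Lemma sdist_noncontextualP (E X : sset) (g : smap E X) (p : sdist R g) :
  sdist_noncontextual p <->
  exists d : dist R (ssect g), forall n (x : X n),
    p n x = distmap (fun u : ssect g => u n x) d.
Proof.
split=> -[d dp]; exists d => n x.
  by apply: dist_ext => y; rewrite dp (distmap_mixture (fun u : ssect g => u n x)).
by move=> y; rewrite (distmap_mixture (fun u : ssect g => u n x)) dp.
Qed.

End Noncontextual.

(** * Global events and sections of the event bundle *)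

Section EventSection.
Variables (S : complex) (O : outcomes S).

Lemma imfset_event (u : events O setT) (s : {fset S}) :
  ((fun x => event (u x I)) @` s)%fset = graph (restr (@subsetT _ [set` s]) u).
Proof.
apply/fsetP => y; apply/imfsetP/graphP => /= [[x xs ->]|[h yE]].
  by exists xs; congr (event (u x _)); exact: Prop_irrelevance.
exists (tag y) => //; rewrite [LHS]yE.
by congr (event (u _ _)); exact: Prop_irrelevance.
Qed.

Lemma event_scmap_subproof (u : events O setT) (s : {fset S}) :
  s \in simplex S ->
  ((fun x => event (u x I) : event_complex O) @` s)%fset
    \in simplex (event_complex O).
Proof.
move=> sS; rewrite imfset_event; apply/event_simplexP.
by exists s => //; exists (restr (@subsetT _ _) u).
Qed.

Definition bsect_of_event (u : events O setT) : bsect (event_bundle O) :=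
  @BSect _ _ (event_bundle O) (ScMap (event_scmap_subproof u)) (fun=> erefl).

(** The outcome carried by [b x] has type [O (tag (b x))]; the section equation transports it to
    [O x]. *)
Definition event_of_bsect (b : bsect (event_bundle O)) : events O setT :=
  fun x _ => ecast z (O z) (bsectK b x) (tagged (b x)).

Lemma bsect_of_eventE (u : events O setT) (s : simplices S) :
  bsect_fiber (bsect_of_event u) s
    = graph_fiber (restr (@subsetT _ [set` val s]) u).
Proof. by apply: val_inj; exact: imfset_event. Qed.

Lemma event_of_bsectE (b : bsect (event_bundle O)) (s : simplices S) :
  graph_fiber (restr (@subsetT _ [set` val s]) (event_of_bsect b))
    = bsect_fiber b s.
Proof.
apply: val_inj => /=; rewrite -imfset_event; apply: eq_imfset => // x /=.
rewrite /event_of_bsect; move: (bsectK b x) => /=.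
by case: (b x) => z o /= e; subst z.
Qed.

Variable R : comPzSemiRingType.

Lemma eta_noncontextual (e : emp R O) :
  emp_noncontextual e <-> bemp_noncontextual (eta e).
Proof.
rewrite emp_noncontextualP bemp_noncontextualP; split=> -[d de].
  exists (distmap bsect_of_event d) => s.
  rewrite [LHS]eta_distE de !distmap_comp; apply: distmap_ext => u /=.
  by rewrite bsect_of_eventE.
exists (distmap event_of_bsect d) => s.
(* [fiber_event] is a left inverse of [graph_fiber], so pushing [eta e] forward along it recovers
   [e]. *)
rewrite -[LHS]distmap_id -(distmap_ext _ (@graph_fiberK _ O s)).
rewrite -[LHS]distmap_comp -eta_distE [eta_dist _ _](de s) !distmap_comp.
by apply: distmap_ext => b /=; rewrite -event_of_bsectE graph_fiberK.
Qed.

End EventSection.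

(** * Sections of the bundle and of its nerve *)

Section NerveSection.
Variables (G S : complex) (f : bundle G S).

Lemma nerve_map_bsectK (b : bsect f) n (x : nerve S n) :
  nerve_map f n (nerve_map b n x) = x.
Proof.
apply: nerve_eq; rewrite /nerve_seq /= -map_comp -[RHS]map_id.
apply: eq_map => s /=; rewrite -imfset_comp -[RHS]imfset_id.
by apply: eq_imfset => // y /=; exact: bsectK.
Qed.

Definition ssect_of_bsect (b : bsect f) : ssect (nerve_map f) :=
  SSect (@nerve_map_bsectK b).

(** For each entry [s] of [x], the image of [s] under [b] is the only subset over [s] of the image
    of the whole union. *)
Lemma ssect_of_bsectE (b : bsect f) n (x : nerve S n) :
  ssect_of_bsect b n x = Defs.split x (bsect_fiber b (nerve_union x)).
Proof.
apply: nerve_eq; rewrite /nerve_seq /=; apply/eq_in_map => s sx.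
have fbs : (f @` (b @` s))%fset = s.
  rewrite -imfset_comp -[RHS]imfset_id.
  by apply: eq_imfset => // y /=; exact: bsectK.
rewrite -[in RHS]fbs; apply: over_uniq; first by rewrite scmapP// nerve_funion.
apply/fsubsetP => _ /imfsetP[y /= ys ->]; rewrite in_imfset//=.
by apply: fsubsetP ys; exact: funion_sub.
Qed.

Lemma nerve1_subproof (K : complex) (s : simplices K) :
  funion [:: val s] \in simplex K.
Proof. by rewrite /funion big_seq1; exact: valP. Qed.

Definition nerve1 (K : complex) (s : simplices K) : nerve K 1 :=
  mk_nerve (eqxx 1%N : size [:: val s] == 1%N) (nerve1_subproof s).

Lemma nerve1K (K : complex) : cancel (@nerve1 K) (@nerve_union K 1).
Proof. by move=> s; apply: val_inj; rewrite /= /funion big_seq1. Qed.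

Lemma nerve_unionK (K : complex) : cancel (@nerve_union K 1) (@nerve1 K).
Proof.
move=> x; apply: nerve_eq.
have -> : nerve_seq (nerve1 (nerve_union x)) = [:: funion (nerve_seq x)] by [].
by case: (nerve_seq x) (size_nerve x) => [|a []]//= _; rewrite /funion big_seq1.
Qed.

(** * From a section of the nerve to a section of the bundle *)

Section Edge.
Variable u : ssect (nerve_map f).

Definition ssect_edge (s : simplices S) : {fset G} :=
  val (nerve_union (u 1%N (nerve1 s))).

Lemma ssect_edge_simplex s : ssect_edge s \in simplex G.
Proof. exact: valP (nerve_union _). Qed.

Lemma ssect_edge_image s : (f @` ssect_edge s)%fset = val s.
Proof.
rewrite -[in RHS](nerve1K s) -(ssectK u (nerve1 s)) /=.
by rewrite funion_map; [|exact: imfset0|exact: imfsetU].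
Qed.

(** The 2-simplex [(t, s)] has last face [t] and middle face the union of [t] and [s], which is [s].
    Its value under [u] is some [(a, b)], whose corresponding faces are [a] and the union of [a] and
    [b]. *)
Lemma ssect_edgeS s t :
  (val t `<=` val s)%fset -> (ssect_edge t `<=` ssect_edge s)%fset.
Proof.
move=> /fsetUidPr ts.
have us : funion [:: val t; val s] \in simplex S.
  by rewrite funion_cons /funion big_seq1 ts; exact: valP.
pose x : nerve S 2 := mk_nerve (eqxx 2%N : size [:: val t; val s] == 2%N) us.
have xt : face (ord_max : 'I_3) x = nerve1 t by apply: nerve_eq; rewrite nerve_faceE.
have xs : face (inord 1 : 'I_3) x = nerve1 s.
  by apply: nerve_eq; rewrite nerve_faceE inordK//= ts.
rewrite /ssect_edge -xt -xs !smap_face.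
change (funion (nerve_seq (nerve_face ord_max (u 2%N x)))
  `<=` funion (nerve_seq (nerve_face (inord 1) (u 2%N x))))%fset.
rewrite [nerve_seq (nerve_face (inord 1) _)]nerve_faceE nerve_faceE inordK//.
apply: fsubset_trans (funion_rec_face _ _) _.
have := size_nerve (u 2%N x).
case: (nerve_seq _) => [|a [|b [|]]]//= _.
by rewrite !funion_cons fsetUA fsubset_refl.
Qed.

Definition vertex_simplex (x : S) : simplices S :=
  Sub [fset x]%fset (simplex1 x).

Lemma ssect_vertex_subproof (x : S) :
  exists y : G, y \in ssect_edge (vertex_simplex x) /\ f y = x.
Proof.
have /fsetP/(_ x) := ssect_edge_image (vertex_simplex x).
by rewrite fset11 => /imfsetP[y /= yx xy]; exists y.
Qed.

Definition ssect_vertex (x : S) : G := projT1 (cid (ssect_vertex_subproof x)).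

Lemma ssect_vertexK x : f (ssect_vertex x) = x.
Proof. by rewrite /ssect_vertex; case: cid => y []. Qed.

(** Monotonicity, applied to the singletons inside [s], puts all the chosen vertices into one
    simplex of [G]; hence the vertex map is simplicial. *)
Lemma ssect_vertex_sub (s : simplices S) :
  (ssect_vertex @` val s `<=` ssect_edge s)%fset.
Proof.
apply/fsubsetP => y /imfsetP[x /= xs ->]; rewrite /ssect_vertex.
case: cid => z [/= zx _]; apply: fsubsetP zx; apply: ssect_edgeS.
by rewrite fsub1set.
Qed.

Lemma ssect_vertex_simplex (s : {fset S}) :
  s \in simplex S -> (ssect_vertex @` s)%fset \in simplex G.
Proof.
move=> sS; apply: simplexS (ssect_edge_simplex (Sub s sS)).
exact: (ssect_vertex_sub (Sub s sS)).
Qed.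

Definition bsect_of_ssect : bsect f :=
  @BSect _ _ f (ScMap ssect_vertex_simplex) ssect_vertexK.

(** Both sides are subsets of the simplex [ssect_edge u s] with image [s], so [over_uniq] identifies
    them. *)
Lemma bsect_of_ssect_edge (s : simplices S) :
  val (bsect_fiber bsect_of_ssect s) = ssect_edge s.
Proof.
have /andP[_ /eqP fs] := valP (bsect_fiber bsect_of_ssect s).
have edge := ssect_edge_simplex s; transitivity (Defs.over f (val s) (ssect_edge s)).
  by rewrite -[in RHS]fs; exact: over_uniq edge (ssect_vertex_sub s).
by rewrite -{1}(ssect_edge_image s) -over_uniq.
Qed.

(** A 1-simplex of the nerve is determined by its union, so it suffices to compare edges. *)
Lemma bsect_of_ssectE (x : nerve S 1) :
  u 1%N x = Defs.split x (bsect_fiber bsect_of_ssect (nerve_union x)).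
Proof.
rewrite -ssect_of_bsectE -[LHS]nerve_unionK -[RHS]nerve_unionK.
congr nerve1; apply: val_inj.
transitivity (ssect_edge (nerve_union x)); first by rewrite /ssect_edge nerve_unionK.
rewrite -bsect_of_ssect_edge /= funion_map//; first exact: imfset0.
exact: imfsetU.
Qed.

End Edge.

Variable R : comPzSemiRingType.

Lemma zeta_noncontextual (p : bemp f R) :
  bemp_noncontextual p <-> sdist_noncontextual (zeta p).
Proof.
rewrite bemp_noncontextualP sdist_noncontextualP; split=> -[d dp].
  exists (distmap ssect_of_bsect d) => n x.
  rewrite [LHS]zeta_distE dp !distmap_comp.
  by apply: distmap_ext => b /=; rewrite -ssect_of_bsectE.
(* Every simplex is the union of a 1-simplex of the nerve, so degree 1 of [zeta p] already
   determines [p]. *)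
exists (distmap bsect_of_ssect d) => s; rewrite -(nerve1K s).
move: (nerve1 s) => x; apply: dist_ext => g.
(* Since [split x] is injective, both sides may be compared after push-forward along it, where the
   left one becomes [zeta p] at [x]. *)
rewrite -2!(distmap_inj _ _ (@split_inj _ _ f _ x)) -zeta_distE.
rewrite [zeta_dist _ _](dp 1%N x) !distmap_comp.
congr dist_fun; apply: distmap_ext => u; exact: bsect_of_ssectE.
Qed.

End NerveSection.

Theorem theorem5p10 (R : comPzSemiRingType) (hR : zero_sum_free R)
    (S : complex) (O : outcomes S) (G : complex) (f : bundle G S) :
  (forall e : emp R O, emp_contextual e <-> bemp_contextual (eta e)) /\
  (forall p : bemp f R, bemp_contextual p <-> sdist_contextual (zeta p)).
Proof.
split=> [e|p]; rewrite /emp_contextual /bemp_contextual /sdist_contextual.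
  by rewrite eta_noncontextual.
by rewrite zeta_noncontextual.
Qed.
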